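(* Parity graphs are ESP.
   Context: All graphs are finite and simple. A graph is a parity graph if any two induced paths between the same pair of vertices have lengths of the same parity. ESP graphs. For a multiset $\Lambda$ of cliques of $G$ and $v\in V(G)$, $d_\Lambda(v)$ denotes the number of members of $\Lambda$ (with multiplicity) that contain $v$. A graph $G=(V,E)$ is equitably subpartitionable (ESP) if for every set $\Lambda$ of (inclusionwise) maximal cliques of $G$ there exist two multisets $\Lambda_1,\Lambda_2$ of cliques of $G$ (not necessarily members of $\Lambda$) such that (i) $|\Lambda_1|+|\Lambda_2|\le|\Lambda|$; (ii) $d_{\Lambda_1}(v)+d_{\Lambda_2}(v)\ge d_\Lambda(v)$ for all $v\in V$; (iii) $\min\{d_{\Lambda_1}(v),d_{\Lambda_2}(v)\}\ge\lfloor d_\Lambda(v)/2\rfloor$ for all $v\in V$. *)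

(* Defs.v *)
From mathcomp Require Import all_boot.

Set Implicit Arguments.
Unset Strict Implicit.
Unset Printing Implicit Defensive.

(* A finite simple graph is a symmetric irreflexive relation
   [e] on a finite type [T]; symmetry and irreflexivity are assumed where the
   definitions are used. *)

Section Graph.

Variables (T : finType) (e : rel T).

(* The path is the vertex sequence [x :: p], as in path.v; its length (number
   of edges) is [size p].  Consecutive vertices are adjacent by [path e x p], so
   inducedness amounts to forbidding chords. *)
Definition induced_path (x y : T) (p : seq T) : Prop :=
  [/\ path e x p, last x p = y, uniq (x :: p) &
      forall i j : nat, i.+1 < j -> j < size (x :: p) ->
        ~~ e (nth x (x :: p) i) (nth x (x :: p) j)].

Definition parity_graph : Prop :=
  forall (x y : T) (p q : seq T),
    induced_path x y p -> induced_path x y q -> odd (size p) = odd (size q).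

Definition clique (K : {set T}) : bool :=
  [forall x in K, forall y in K, (x != y) ==> e x y].

Definition maximal_clique (K : {set T}) : bool := maxset clique K.

(* Finite multisets of vertex sets are represented by sequences, the order being
   irrelevant: only [size], [all] and [count] are applied to them. *)
Definition cdeg (L : seq {set T}) (v : T) : nat :=
  count (fun K : {set T} => v \in K) L.

Definition ESP : Prop :=
  forall Lam : {set {set T}},
    (forall K, K \in Lam -> maximal_clique K) ->
    exists L1 L2 : seq {set T},
      [/\ all clique L1 /\ all clique L2,
          size L1 + size L2 <= #|Lam|,
          forall v, cdeg (enum Lam) v <= cdeg L1 v + cdeg L2 v &
          forall v, (cdeg (enum Lam) v)./2 <= minn (cdeg L1 v) (cdeg L2 v)].

End Graph.

(* Main.v *)
Require Import Defs.
From mathcomp Require Import all_boot.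
From mathcomp Require Import ssralg ssrnum ssrint zify.

Set Implicit Arguments.
Unset Strict Implicit.
Unset Printing Implicit Defensive.

(** Parity graphs are taken apart by splits: a split of a vertex set S is a
partition of S into A and B, each with at least two vertices, such that the
edges between A and B form a complete bipartite graph between a subset of A and
a subset of B.

The property proved by induction on the number of vertices is [halvable]: every
list L of cliques of G[S] can be traded for two lists of at most size L cliques
in total, such that each vertex keeps its degree exactly and has it distributed
over the two lists as evenly as possible.  Allowing repetitions and
non-maximal cliques costs nothing, and it makes the property pass to
compositions.

Composition ([halvable_split]).  Choose a0 in A and b0 in B, adjacent if any
edge crosses the split.  A clique K that meets both sides leaves the trace
b0 |: (K :&: A) on the side of A, where b0 stands for the missing part, and
likewise a trace marked by a0 on the side of B.  Halve both lists of traces.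
The degree of b0 on one side and that of a0 on the other both count the
crossing cliques, and both are halved evenly; so, up to exchanging the two lists
of one side, the cliques marked by b0 can be matched with those marked by a0 and
merged in pairs into cliques of A :|: B.  There are as many merges as crossing
cliques, which compensates for their having two traces.

Structure ([parity_structure]).  A connected parity graph G[S] is a clique, is
bipartite, or has a split.  Consider the distance levels from a vertex v.
Adjacent vertices of one level have the same neighbours one level below
([common_parents]).
- Suppose that for some v an edge lies inside a level at distance at least 2.
  Let k be the last level of v that contains an edge, and D a connected
  component, with an edge, of the subgraph induced by level k.  Together with
  the components of the part above level k that are attached to D only, D is one
  side of a split ([level_edge_split]): the parents are common to D, and a
  vertex above D whose component is attached elsewhere too sees all or none of D
  ([complete_attachment]).
- Suppose that there is no such edge for any v, but that there is a triangle.
  Two vertices of a triangle are equidistant from any given vertex u off it, so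
  u is adjacent to both ([two_of_three]).  This forces nonadjacent vertices to
  be twins ([nonadj_twins]), and a pair of twins is a side of a split.
- Otherwise no edge joins two vertices of one level, and the parity of the
  distance is a 2-colouring.

Base cases.  In a clique all vertex subsets are cliques and the lists are
written down ([halvable_clique]).  For a bipartite graph the claim is the
equitable 2-colouring of the edges of a bipartite multigraph
([halvable_bipartite]). *)

(** Boolean hypotheses are atoms on which lia would split, at exponential cost;
only comparisons of numbers and of parities are passed on to it. *)
Ltac arith :=
  repeat match goal with
  | H : is_true ?b |- _ =>
    lazymatch b with
    | leq _ _ => fail
    | @eq_op _ ?x _ =>
      let t := type of x in
      tryif first [unify t nat | unify t bool] then fail else clear H
    | ~~ (@eq_op _ ?x _) =>
      let t := type of x in
      tryif first [unify t nat | unify t bool] then fail else clear H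
    | _ => clear H
    end
  end; lia.

(** * Induced paths *)

Section Chordless.

Variables (T : finType) (e : rel T).
Hypotheses (e_sym : symmetric e) (e_irr : irreflexive e).

(** A recursive form of inducedness, suited to building paths vertex by
vertex. *)
Fixpoint chordless (x : T) (p : seq T) : bool :=
  if p is y :: q then
    [&& e x y, x \notin p, ~~ has (e x) q & chordless y q]
  else true.

Lemma chordless_path x p : chordless x p -> path e x p.
Proof. by elim: p x => //= y q IHq x /and4P[-> _ _ /IHq]. Qed.

Lemma chordless_uniq x p : chordless x p -> uniq (x :: p).
Proof.
elim: p x => // y q IHq x /= /and4P[_ xNyq _ /IHq uniq_yq].
by rewrite xNyq.
Qed.

Lemma chordless_induced x p : chordless x p -> induced_path e x (last x p) p.
Proof.
move=> cp; split=> //; [exact: chordless_path | exact: chordless_uniq |].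
elim: p x cp => [|y q IHq] x /=; first by move=> _ [|i] [|[|j]].
case/and4P=> _ _ /hasPn xNq cq [|i] [|[|j]] //= ltij ltj.
  by apply: xNq; apply: mem_nth.
have := IHq y cq i j.+1 ltij ltj.
by rewrite /= !(set_nth_default x y) //=; arith.
Qed.

Lemma chordless_cat x p q :
    chordless x p -> chordless (last x p) q ->
    (forall y z, y \in belast x p -> z \in q -> (y != z) && ~~ e y z) ->
  chordless x (p ++ q).
Proof.
elim: p x => //= y p IHp x /and4P[exy xNyp xNp cp] cq sep.
have xNq z : z \in q -> (x != z) && ~~ e x z by apply: sep; rewrite mem_head.
apply/and4P; split=> //; last first.
- by apply: IHp => // u z uP; apply: sep; rewrite inE uP orbT.
- rewrite has_cat (negPf xNp) /=; apply/hasPn => z zq.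
  by have /andP[] := xNq z zq.
rewrite -cat_cons mem_cat (negPf xNyp) /=; apply/negP => xq.
by have /andP[/eqP] := xNq x xq.
Qed.

(** A new first vertex x is connected to the last of its neighbours on the path;
what precedes that neighbour is dropped, so that no chord remains. *)
Lemma chordless_attach x y p :
    chordless y p -> (x \in y :: p) || has (e x) (y :: p) ->
  exists q, [/\ chordless x q, last x q = last y p & {subset q <= y :: p}].
Proof.
elim: p y => [|z p IHp] y.
  move=> _; rewrite inE /= orbF => /orP[/eqP->|exy]; first by exists [::].
  exists [:: y]; split=> //=; rewrite exy inE /= andbT.
  by apply/eqP => xy; rewrite xy e_irr in exy.
move=> cyp; have [attx _|Nattx] := boolP ((x \in z :: p) || has (e x) (z :: p)).
  have /and4P[_ _ _ czp] := cyp.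
  have [q [cq lq subq]] := IHp z czp attx; exists q; split=> //.
  by move=> t /subq tq; rewrite inE tq orbT.
move: Nattx; rewrite negb_or => /andP[xNzp exNzp].
rewrite in_cons (negPf xNzp) orbF.
have -> : has (e x) [:: y, z & p] = e x y.
  by rewrite -cat1s has_cat (negPf exNzp) has_seq1 orbF.
case/orP=> [/eqP->|exy].
  by exists (z :: p); split=> // t tzp; rewrite inE tzp orbT.
exists (y :: z :: p); split=> //; apply/and4P; split=> //.
rewrite in_cons (negPf xNzp) orbF.
by apply/eqP => xy; rewrite xy e_irr in exy.
Qed.

Lemma path_chordless x p :
    path e x p ->
  exists q, [/\ chordless x q, last x q = last x p & {subset q <= p}].
Proof.
elim: p x => [|y p IHp] x /=; first by exists [::].
case/andP=> exy /IHp[q [cq lq subq]].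
have [|r [cr lr subr]] := @chordless_attach x y q cq; first by rewrite /= exy orbT.
exists r; split=> //; first by rewrite lr.
by move=> t /subr; rewrite !inE => /orP[->//|/subq->]; rewrite orbT.
Qed.

Hypothesis par : parity_graph e.

Lemma chordless_parity x p q :
    chordless x p -> chordless x q -> last x p = last x q ->
  odd (size p) = odd (size q).
Proof.
move=> /chordless_induced cp /chordless_induced cq lpq.
by rewrite lpq in cp; apply: par cp cq.
Qed.

(** In a 2-coloured part of the graph the colours of the ends determine the
parity of the length; here the colour is the parity of a level d. *)
Lemma bipartite_path_parity (V0 : pred T) (d : T -> nat) x p :
    (forall y z, V0 y -> V0 z -> e y z -> odd (d y) != odd (d z)) ->
    all V0 (x :: p) -> path e x p ->
  odd (size p) = odd (d x) (+) odd (d (last x p)).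
Proof.
move=> bip; elim: p x => [|y p IHp] x /=; first by rewrite addbb.
case/and3P=> Vx Vy Vp /andP[exy pth].
rewrite (IHp y) /= ?Vy //; have := bip x y Vx Vy exy.
by case: (odd (d x)); case: (odd (d y)) => //=; case: (odd _).
Qed.

(** * Distance levels *)

(** Characterizes the distance from v in a connected G[S] by the local
properties through which it is used. *)
Definition is_dist (S : {set T}) (v : T) (d : T -> nat) : Prop :=
  [/\ d v = 0, (forall x, x \in S -> d x = 0 -> x = v),
      (forall x y, x \in S -> y \in S -> e x y -> d x <= (d y).+1) &
      (forall x, x \in S -> 0 < d x ->
         exists y, [/\ y \in S, e x y & d x = (d y).+1])].

(** The last clause says that the edges between A and B form a complete bipartite
graph between a subset of A and a subset of B. *)
Definition splits (S A B : {set T}) : Prop :=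
  [/\ A :|: B = S, [disjoint A & B], 1 < #|A|, 1 < #|B| &
      forall x x' y y', x \in A -> x' \in A -> y \in B -> y' \in B ->
        e x y -> e x' y' -> e x y'].

Section Levels.

Variables (S : {set T}) (v : T) (d : T -> nat).
Hypothesis (dist_d : is_dist S v d).

Let d_src : d v = 0. Proof. by case: dist_d. Qed.
Let d_eq0 x : x \in S -> d x = 0 -> x = v. Proof. by case: dist_d => ? + ? ?; apply. Qed.
Let d_lip x y : x \in S -> y \in S -> e x y -> d x <= (d y).+1.
Proof. by case: dist_d => ? ? + ?; apply. Qed.
Let d_parent x : x \in S -> 0 < d x -> exists y, [/\ y \in S, e x y & d x = (d y).+1].
Proof. by case: dist_d => ? ? ?; apply. Qed.

Lemma far_nonadj x y : x \in S -> y \in S -> (d y).+1 < d x -> ~~ e x y.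
Proof. by move=> xS yS lt; apply/negP => /(d_lip xS yS); rewrite leqNgt lt. Qed.

Lemma level_neq x y : d x != d y -> x != y.
Proof. by apply: contra => /eqP->. Qed.

Lemma descend x :
    x \in S ->
  exists p, [/\ chordless x p, last x p = v, size p = d x &
                forall z, z \in p -> (z \in S) && (d z < d x)].
Proof.
have [n] := ubnP (d x); elim: n x => // n IHn x; rewrite ltnS => le_n xS.
have [d0|d_gt0] := posnP (d x).
  by exists [::]; rewrite d0 /= (d_eq0 xS d0).
have [y [yS exy dxy]] := d_parent xS d_gt0.
have [||p [cp lp szp below]] := IHn y; rewrite -?dxy //.
exists (y :: p); split=> //=; [| by rewrite szp |].
- apply/and4P; split=> //.
    rewrite inE negb_or level_neq ?dxy /=; last by arith.
    by apply/negP => /below; arith.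
  by apply/hasPn => z /below /andP[zS ltz]; apply: far_nonadj => //; arith.
- by move=> z; rewrite inE => /orP[/eqP->|/below/andP[-> ltz]]; rewrite ?yS /=; arith.
Qed.

(** Otherwise y, x, u and a shortest path from u to v form an induced path that
is longer by one than a shortest path from y to v. *)
Lemma common_parents x y u :
    x \in S -> y \in S -> u \in S -> e x y -> d x = d y ->
    e x u -> d x = (d u).+1 ->
  e y u.
Proof.
move=> xS yS uS exy dxy exu dxu; apply/negPn/negP => Neyu.
have [p [cp lp szp below]] := descend uS.
have [q [cq lq szq _]] := descend yS.
have far z t : z \in S -> d z = (d u).+1 -> t \in p -> (z != t) && ~~ e z t.
  move=> zS dz /below /andP[tS ltt]; rewrite far_nonadj //; last by arith.
  by rewrite level_neq //; arith.
have notin z : z \in S -> d z = (d u).+1 -> z \notin p.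
  by move=> zS dz; apply/negP => /(far z z zS dz); rewrite eqxx.
have nohas z : z \in S -> d z = (d u).+1 -> ~~ has (e z) p.
  by move=> zS dz; apply/hasPn => t /(far z t zS dz) /andP[].
have cyp : chordless y [:: x, u & p].
  have dyu : d y = (d u).+1 by rewrite -dxy.
  have nyx : y != x by apply/eqP => yx; rewrite yx e_irr in exy.
  rewrite /= e_sym exy exu (negPf Neyu) cp !inE !negb_or nyx !notin ?nohas //=.
  by rewrite !level_neq ?dxu ?dyu //=; arith.
have := chordless_parity cyp cq; rewrite /= lp lq szq szp -dxy dxu => /(_ erefl).
by rewrite /=; case: odd.
Qed.

(** If b and c have a common parent, it yields an induced path of length 2 between
them.  If not, the given path continued by a shortest path from c to v is an
induced path from b, to be compared with a shortest path from b to v.  The last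
hypothesis on the interior vertices keeps the continuation free of chords. *)
Lemma no_odd_path_above b c p :
    b \in S -> c \in S -> d b = d c -> 0 < d b -> b != c -> ~~ e b c ->
    chordless b p -> last b p = c ->
    (forall y, y \in belast b p -> [/\ y \in S, d b <= d y &
       d y = d b -> forall q, q \in S -> (d q).+1 = d b -> e y q -> e b q]) ->
  ~~ odd (size p).
Proof.
move=> bS cS dbc db_gt0 neq_bc Nebc cp lp above.
have [|q [qS ecq dcq]] := d_parent cS; first by rewrite -dbc.
have [ebq|Nebq] := boolP (e b q).
  have c2 : chordless b [:: q; c].
    rewrite /= ebq (e_sym q) ecq orbF Nebc !inE negb_or neq_bc !andbT.
    by rewrite !level_neq // ?dbc dcq; arith.
  by rewrite (chordless_parity cp c2).
have [r [cr lr szr below]] := descend qS.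
have [t [ct lt szt _]] := descend bS.
have ccr : chordless c (q :: r).
  rewrite /= ecq cr inE negb_or level_neq ?dcq /=; last by arith.
  rewrite andbT; apply/andP; split; first by apply/negP => /below; arith.
  by apply/hasPn => z /below /andP[zS ltz]; apply: far_nonadj => //; arith.
have cpr : chordless b (p ++ q :: r).
  apply: chordless_cat => //; first by rewrite lp.
  move=> y z /above[yS ley par_y]; rewrite inE.
  case/orP=> [/eqP->|/below/andP[zS ltz]]; last first.
    by apply/andP; split; [apply: level_neq; arith | apply: far_nonadj => //; arith].
  apply/andP; split; first by apply: level_neq; arith.
  have [dy|/eqP ndy] := eqVneq (d y) (d b); last by apply: far_nonadj => //; arith.
  by apply: contra Nebq; apply: par_y => //; rewrite dbc dcq.
have := chordless_parity cpr ct; rewrite last_cat /= lr lt => /(_ erefl).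
rewrite size_cat /= szr szt dbc dcq oddD /=.
by case: odd; case: odd.
Qed.

Lemma dist1_adj x : x \in S -> d x = 1 -> e v x.
Proof.
move=> xS dx; have [|y [yS exy]] := d_parent xS; first by rewrite dx.
by rewrite dx => -[/esym/(d_eq0 yS) <-]; rewrite e_sym.
Qed.

Definition restr (U : {set T}) : rel T := [rel x y | [&& x \in U, y \in U & e x y]].

Lemma restr_path (U : {set T}) x p :
  x \in U -> path (restr U) x p -> path e x p /\ {subset x :: p <= U}.
Proof.
elim: p x => [|y p IHp] x xU /=.
  by split=> // z; rewrite inE => /eqP->.
case/andP=> /and3P[_ yU exy] /(IHp _ yU)[pth sub]; split; first by rewrite exy.
by move=> z; rewrite inE => /orP[/eqP->|/sub].
Qed.

(** Here w lies above level k, is adjacent to the end a of the level edge ab, and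
is linked above level k to a vertex c of level k that is adjacent to neither end.
Suppose that w is not adjacent to b.  If b has a neighbour on the link, then an
induced path of odd length leads from w to b, whereas w, a, b has length 2.
Otherwise an induced path from a to c along the link, which has even length, can
be prolonged by b, against [no_odd_path_above]. *)
Lemma complete_attachment k a b c w w' (U := [set x in S | k < d x]) :
    0 < k ->
    (forall x y, x \in S -> y \in S -> e x y -> k < d x -> d x != d y) ->
    a \in S -> b \in S -> c \in S -> d a = k -> d b = k -> d c = k ->
    e a b -> c != a -> c != b -> ~~ e a c -> ~~ e b c ->
    w \in U -> e w a -> connect (restr U) w w' -> e w' c ->
  e w b.
Proof.
move=> k_gt0 upper aS bS cS da db dc eab neq_ca neq_cb Neac Nebc wU ewa.
case/connectP=> r /(restr_path wU)[pr subU] -> er.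
apply/negPn/negP => Newb.
have inU x : x \in U -> (x \in S) /\ (k < d x) by rewrite inE => /andP[].
have bip x y : x \in S -> y \in U -> e x y -> odd (d x) != odd (d y).
  move=> xS /inU[yS lty] exy.
  have := upper y x yS xS; rewrite e_sym exy => /(_ isT lty).
  have := d_lip xS yS exy; have := d_lip yS xS; rewrite e_sym exy => /(_ isT).
  by arith.
have [/inU[wS ltw]] := wU.
have [/hasP[x xr ebx]|Nebr] := boolP (has (e b) (w :: r)).
  have [r1 [pr1 subr1 lr1]] : exists r1, [/\ path e w r1, {subset r1 <= U}
      & last w r1 = x].
    case/splitPl: xr pr subU => r1 r2 lr1; rewrite cat_path => /andP[pr1 _] subU.
    exists r1; split=> // z zr1; apply: subU.
    by rewrite inE mem_cat zr1 orbT.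
  have pb : path e w (rcons r1 b) by rewrite rcons_path pr1 lr1 e_sym.
  have [q [cq lq subq]] := path_chordless pb.
  rewrite last_rcons in lq.
  have c2 : chordless w [:: a; b].
    have neq_ab : a != b by apply/eqP => ab; rewrite ab e_irr in eab.
    rewrite /= ewa eab orbF Newb !inE negb_or neq_ab !level_neq ?da ?db //=; arith.
  have := chordless_parity cq c2 lq.
  rewrite (@bipartite_path_parity (fun x => (x \in U) || (x == b)) d w) /=.
  - rewrite lq db; have := bip a w aS wU; rewrite e_sym ewa da => /(_ isT).
    by case: odd; case: odd.
  - move=> y z /orP[yU|/eqP->] /orP[zU|/eqP->]; rewrite ?e_irr //; last exact: bip.
      by apply: bip => //; case/inU: yU.
    by rewrite e_sym eq_sym; apply: bip.
  - rewrite wU /=; apply/allP => z /subq; rewrite mem_rcons inE orbC.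
    by case/orP=> [/subr1->//|->]; rewrite orbT.
  - exact: chordless_path.
have pa : path e a (w :: rcons r c).
  by rewrite /= e_sym ewa rcons_path pr.
have [q [cq lq subq]] := path_chordless pa.
rewrite /= last_rcons in lq.
have q_sub z : z \in q -> (z \in w :: r) || (z == c).
  by move/subq; rewrite -rcons_cons mem_rcons inE orbC.
have cbq : chordless b (a :: q).
  rewrite /= e_sym eab cq andbT inE negb_or -andbA /=; apply/and3P; split.
  - by apply/eqP => ab; rewrite ab e_irr in eab.
  - apply/negP => /q_sub /orP[/subU/inU[_]|/eqP bc]; first by rewrite db ltnn.
    by rewrite bc eqxx in neq_cb.
  apply/hasPn => z /q_sub /orP[zr|/eqP->//].
  by apply: (hasPn Nebr).
have := @no_odd_path_above b c (a :: q) bS cS.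
rewrite db dc k_gt0 eq_sym => /(_ erefl isT neq_cb Nebc cbq lq) even_aq.
have cNq : c \notin belast a q.
  by have := chordless_uniq cq; rewrite lastI rcons_uniq lq => /andP[].
have odd_aq : odd (size (a :: q)).
  rewrite /= (@bipartite_path_parity [pred x | (x \in U) || (x \in [:: a; c])] d a).
  - by rewrite lq da dc addbb.
  - have ac x y : x \in [:: a; c] -> y \in [:: a; c] -> ~~ e x y.
      by rewrite !inE => /orP[]/eqP-> /orP[]/eqP->; rewrite ?e_irr // e_sym.
    have acS x : x \in [:: a; c] -> x \in S by rewrite !inE => /orP[]/eqP->.
    move=> x y /= /orP[xU|xac] /orP[yU|yac] exy.
    + by apply: bip => //; case/inU: xU.
    + by rewrite eq_sym; apply: bip; rewrite 1?e_sym // acS.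
    + by apply: bip => //; apply: acS.
    + by rewrite (negPf (ac _ _ xac yac)) in exy.
  - rewrite /= !inE eqxx orbT /=; apply/allP => z /q_sub /= /orP[/subU->//|/eqP->].
    by rewrite !inE eqxx !orbT.
  - exact: chordless_path.
suff: ~~ odd (size (a :: q)) by rewrite odd_aq.
apply: even_aq => y; rewrite inE => /orP[/eqP->|yq].
  by split; rewrite ?db.
have [->|neq_ya] := eqVneq y a.
  split; rewrite ?da // => _ q' q'S dq' eaq'.
  by apply: (@common_parents a); rewrite ?da.
have : y \in q by move/mem_belast: yq; rewrite inE (negPf neq_ya).
case/q_sub/orP=> [/subU/inU[yS lty]|/eqP yc]; last by rewrite -yc yq in cNq.
by split=> //; arith.
Qed.

(** The side A of the split consists of a component D of the last level k that
contains an edge, and of the vertices above level k that reach no other vertex of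
level k from above.  The side B contains v and all vertices below level k, hence
at least two vertices because k > 1. *)
Lemma level_edge_split a b :
    v \in S -> a \in S -> b \in S -> e a b -> d a = d b -> 1 < d a ->
  exists A B, splits S A B.
Proof.
move=> vS aS bS eab dab da_gt1.
pose P (k : nat) := [exists x in S, exists y in S, [&& e x y, d x == k & d y == k]].
have Pda : P (d a).
  apply/exists_inP; exists a => //; apply/exists_inP; exists b => //.
  by rewrite eab dab eqxx.
have P_ub k : P k -> k <= \max_x d x.
  by case/exists_inP=> x _ /exists_inP[y _ /and3P[_ /eqP<- _]]; apply: leq_bigmax.
have exP : exists k, P k by exists (d a).
case: (ex_maxnP exP P_ub) => k Pk k_max {P_ub}.
have k_gt1 : 1 < k by apply: leq_trans da_gt1 (k_max _ Pda).
have upper x y : x \in S -> y \in S -> e x y -> k < d x -> d x != d y.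
  move=> xS yS exy; apply: contraL => /eqP dxy; rewrite -leqNgt; apply: k_max.
  apply/exists_inP; exists x => //; apply/exists_inP; exists y => //.
  by rewrite exy dxy eqxx.
case/exists_inP: Pk => a1 a1S /exists_inP[b1 b1S /and3P[ea1b1 /eqP da1 /eqP db1]].
move=> {a b aS bS eab dab da_gt1 Pda exP k_max P}.
pose N := [set x in S | d x == k].
pose U := [set x in S | k < d x].
pose D := [set x | connect (restr N) a1 x].
pose X := [set x in U | ~~ [exists c in N :\: D, exists w,
                               connect (restr U) x w && e w c]].
have a1N : a1 \in N by rewrite inE a1S da1 eqxx.
have DN x : x \in D -> x \in N.
  rewrite inE => /connectP[p /(restr_path a1N)[_ sub] ->].
  by apply: sub; apply: mem_last.
have NS x : x \in N -> x \in S /\ d x = k by rewrite inE => /andP[-> /eqP].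
have US x : x \in U -> x \in S /\ k < d x by rewrite inE => /andP[].
have D_closed x y : x \in D -> y \in N -> e x y -> y \in D.
  move=> xD yN exy; move: (xD); rewrite !inE => /connect_trans; apply.
  by apply: connect1; rewrite /restr /= exy yN DN.
have X_closed x y : x \in X -> y \in U -> e x y -> y \in X.
  rewrite !inE => /andP[xU xX] yU exy; rewrite yU /=; apply: contra xX.
  case/exists_inP=> c cN /existsP[w /andP[yw ewc]].
  apply/exists_inP; exists c => //; apply/existsP; exists w; rewrite ewc andbT.
  by apply: connect_trans yw; apply: connect1; rewrite /restr /= exy !inE xU yU.
have X_only x y : x \in X -> y \in S -> e x y -> (y \in D) || (y \in X).
  move=> xX yS exy; have : x \in X := xX; rewrite inE => /andP[xU Nx].
  have [_ ltx] := US x xU.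
  have [lty|ley] := ltnP k (d y); first by rewrite (X_closed x) ?orbT // inE yS.
  have yN : y \in N.
    have := d_lip (US x xU).1 yS exy; rewrite inE yS /=; arith.
  apply/orP; left; apply: contraR Nx => NyD.
  apply/exists_inP; exists y; first by rewrite inE NyD.
  by apply/existsP; exists x; rewrite connect0.
(* Adjacency to y passes along the edges of the connected set D: by common
   parents if y lies below D, by complete attachment if y lies above. *)
have D_uniform y x x' : y \in S -> y \notin D -> y \notin X ->
    x \in D -> x' \in D -> e x y -> e x' y.
  move=> yS NyD NyX xD x'D.
  suff step z z' : z \in D -> z' \in D -> e z z' -> e z y -> e z' y.
    have D_conn : connect (restr N) x x'.
      have sym : connect_sym (restr N).
        apply: sym_connect_sym => z z' /=.
        by rewrite /restr /= e_sym andbCA.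
      by move: xD x'D; rewrite !inE sym => /connect_trans; apply.
    case/connectP: D_conn => p pp ->; elim: p x xD pp => //= z p IHp x xD.
    case/andP=> /and3P[xN zN exz] pp exy.
    have zD := D_closed x z xD zN exz.
    by apply: IHp => //; apply: step exy.
  move=> zD z'D ezz' ezy.
  have [[zS dz] [z'S dz']] := (NS z (DN z zD), NS z' (DN z' z'D)).
  have [lty|] := ltnP k (d y); last rewrite leq_eqVlt => /orP[/eqP dy|lty].
  - have yU : y \in U by rewrite inE yS.
    have : y \notin X := NyX; rewrite inE yU negbK.
    case/exists_inP=> c /setDP[cN NcD] /existsP[w /andP[yw ewc]].
    have [cS dc] := NS c cN.
    have cD t : t \in D -> (c != t) && ~~ e t c.
      move=> tD; apply/andP; split.
        by apply: contraNneq NcD => ->.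
      by apply: contra NcD; apply: D_closed.
    have [/andP[cz Nezc] /andP[cz' Nez'c]] := (cD z zD, cD z' z'D).
    rewrite e_sym; apply: (@complete_attachment k z z' c y w) => //; first by arith.
    by rewrite e_sym.
  - by rewrite (D_closed z y) // ?inE ?yS ?dy ?eqxx in NyD.
  - apply: (@common_parents z z' y) => //; first by rewrite dz.
    by have := d_lip zS yS ezy; arith.
exists (D :|: X), (S :\: (D :|: X)); split.
- apply/setP => x; rewrite in_setU in_setD.
  by have [/setUP[/DN/NS[->]|/setIdP[/US[->]]]|] := boolP (x \in D :|: X).
- by rewrite disjoints_subset setCD subsetUr.
- have b1D : b1 \in D.
    by apply: (D_closed a1) => //; rewrite inE ?connect0 // b1S db1 eqxx.
  have a1D : a1 \in D by rewrite inE connect0.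
  apply/card_gt1P; exists a1, b1; split; [by apply/setUP; left.. |].
  by apply/eqP => ab; rewrite ab e_irr in ea1b1.
- have [|q [qS _ dq]] := d_parent a1S; first by arith.
  have low x : x \in S -> d x < k -> x \in S :\: (D :|: X).
    move=> xS ltx; rewrite inE xS andbT inE negb_or; apply/andP; split.
      by apply/negP => /DN/NS[_]; arith.
    by apply/negP; rewrite inE => /andP[/US[_]]; arith.
  have vB : v \in S :\: (D :|: X) by apply: low => //; arith.
  have qB : q \in S :\: (D :|: X) by apply: low => //; arith.
  apply/card_gt1P; exists v, q; split=> //.
  by apply: level_neq; arith.
move=> x x' y y' xA x'A /setDP[yS]; rewrite inE negb_or => /andP[NyD NyX].
case/setDP=> y'S; rewrite inE negb_or => /andP[Ny'D Ny'X] exy ex'y'.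
have inD z t : z \in D :|: X -> t \in S -> t \notin D -> t \notin X -> e z t -> z \in D.
  move=> /setUP[//|zX] tS NtD NtX ezt.
  by have := X_only z t zX tS ezt; rewrite (negPf NtD) (negPf NtX).
by apply: (D_uniform y' x' x) => //; [apply: inD ex'y' | apply: inD exy].
Qed.

End Levels.
(** * Splits of parity graphs *)

Lemma dist_exists (S : {set T}) :
    (forall x y, x \in S -> y \in S -> connect (restr S) x y) ->
  exists D : T -> T -> nat, forall v, v \in S -> is_dist S v (D v).
Proof.
move=> conn.
pose step (B : {set T}) := B :|: [set y in S | [exists x in B, e x y]].
pose ball v n := iter n step [set v].
have ballS v n x : v \in S -> x \in ball v n -> x \in S.
  move=> vS; elim: n x => [|n IHn] x; first by rewrite inE => /eqP->.
  by case/setUP=> [/IHn//|]; rewrite inE => /andP[].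
have ex_ball v x : exists n, (v \in S) && (x \in S) ==> (x \in ball v n).
  have [vS|] := boolP (v \in S); last by exists 0.
  have [xS|] := boolP (x \in S); last by exists 0.
  case/connectP: (conn v x vS xS) => p + ->.
  elim/last_ind: p => [|p z IHp]; first by exists 0; rewrite /= inE.
  rewrite rcons_path last_rcons => /andP[/IHp[n /= vn] /and3P[_ zS ez]].
  exists n.+1; rewrite /= !inE zS /=; apply/orP; right.
  by apply/exists_inP; exists (last v p).
pose D v x := ex_minn (ex_ball v x).
exists D => v vS.
have D_min x n : x \in ball v n -> D v x <= n.
  by move=> xn; rewrite /D; case: ex_minnP => m _; apply; rewrite xn implybT.
have D_ball x : x \in S -> x \in ball v (D v x).
  by move=> xS; rewrite /D; case: ex_minnP => m; rewrite vS xS.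
split.
- by apply/eqP; rewrite -leqn0 D_min // inE.
- by move=> x /D_ball + d0; rewrite d0 inE => /eqP.
- move=> x y xS yS exy; apply: D_min; rewrite /= !inE xS /=; apply/orP; right.
  by apply/exists_inP; exists y; rewrite ?D_ball // e_sym.
- move=> x xS; case Dx: (D v x) => [//|n] _.
  have := D_ball x xS; rewrite Dx => /setUP[/D_min|]; first by rewrite Dx ltnn.
  rewrite inE => /andP[_ /exists_inP[y yn eyx]].
  have yS := ballS _ _ _ vS yn.
  exists y; split; rewrite 1?e_sym //; apply/eqP; rewrite eqSS eqn_leq D_min // andbT.
  rewrite -ltnS -Dx; apply: D_min; rewrite /= !inE xS /=; apply/orP; right.
  by apply/exists_inP; exists y; rewrite ?D_ball.
Qed.

Definition triangle x y z := [&& e x y, e y z & e x z].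

(** The three distances from u differ by at most one from each other, so two of
them agree; the corresponding edge lies in a level of u, which must be the first. *)
Lemma two_of_three (S : {set T}) D :
    (forall v, v \in S -> is_dist S v (D v)) ->
    (forall v a b, v \in S -> a \in S -> b \in S -> e a b ->
       D v a = D v b -> D v a <= 1) ->
    forall x y z u, x \in S -> y \in S -> z \in S -> u \in S -> triangle x y z ->
      u != x -> u != y -> u != z ->
  [|| e u x && e u y, e u y && e u z | e u x && e u z].
Proof.
move=> dist low x y z u xS yS zS uS /and3P[exy eyz exz] ux uy uz.
have [_ d_eq0 d_lip _] := dist u uS.
have adj a b : a \in S -> b \in S -> e a b -> u != a -> D u a = D u b -> e u a && e u b.
  move=> aS bS eab ua dab.
  have le1 := low u a b uS aS bS eab dab.
  have d1 : D u a = 1.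
    by apply/eqP; rewrite eqn_leq le1 lt0n; apply: contra ua => /eqP/(d_eq0 a aS)->.
  by rewrite !(dist1_adj (dist u uS)) // -dab.
have lip a b : a \in S -> b \in S -> e a b -> D u a <= (D u b).+1 /\ D u b <= (D u a).+1.
  by move=> aS bS eab; split; apply: d_lip => //; rewrite e_sym.
have [? ?] := lip _ _ xS yS exy; have [? ?] := lip _ _ yS zS eyz.
have [? ?] := lip _ _ xS zS exz.
have : [\/ D u x = D u y, D u y = D u z | D u x = D u z].
  have [|n1] := eqVneq (D u x) (D u y); first by constructor 1.
  have [|n2] := eqVneq (D u y) (D u z); first by constructor 2.
  constructor 3; arith.
case=> h.
- by rewrite (adj x y).
- by rewrite (adj y z) ?orbT.
- by rewrite (adj x z) ?orbT.
Qed.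

(** Every vertex lies in a triangle.  Let u and w be nonadjacent and z adjacent to
u but not to w.  In a triangle w, p, q, both p and q are adjacent to z, and one
of them, say p, is adjacent to u; then w has only one neighbour in the triangle
z, p, u.  So u and w have the same neighbours. *)
Lemma nonadj_twins (S : {set T}) t1 t2 t3 :
    (forall x y z u, x \in S -> y \in S -> z \in S -> u \in S -> triangle x y z ->
      u != x -> u != y -> u != z ->
      [|| e u x && e u y, e u y && e u z | e u x && e u z]) ->
    t1 \in S -> t2 \in S -> t3 \in S -> triangle t1 t2 t3 ->
    forall u w, u \in S -> w \in S -> u != w -> ~~ e u w ->
  exists A B, splits S A B.
Proof.
move=> two t1S t2S t3S tri.
have in_tri w : w \in S -> exists p q, [/\ p \in S, q \in S & triangle w p q].
  move=> wS; have /and3P[e12 e23 e13] := tri.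
  have [->|w1] := eqVneq w t1; first by exists t2, t3.
  have [->|w2] := eqVneq w t2.
    by exists t1, t3; rewrite /triangle e_sym e12 e13 e23.
  have [->|w3] := eqVneq w t3.
    by exists t1, t2; rewrite /triangle e_sym e13 e12 e_sym e23.
  have /or3P[] := two _ _ _ w t1S t2S t3S wS tri w1 w2 w3 => /andP[ea eb].
  - by exists t1, t2; rewrite /triangle ea eb e12.
  - by exists t2, t3; rewrite /triangle ea eb e23.
  - by exists t1, t3; rewrite /triangle ea eb e13.
have e_neq x y : e x y -> x != y by apply: contraTneq => ->; rewrite e_irr.
have twins u w z : u \in S -> w \in S -> z \in S -> u != w -> ~~ e u w ->
    e z u -> e z w.
  move=> uS wS zS uw Neuw ezu; apply/negPn/negP => Nezw.
  have zw : z != w by apply: contraNneq Neuw => <-; rewrite e_sym.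
  have [p [q [pS qS wpq]]] := in_tri w wS.
  have /and3P[ewp epq ewq] := wpq.
  have adj_neq x y : e w x -> ~~ e y w -> y != x.
    by move=> ewx; apply: contraNneq => ->; rewrite e_sym.
  have zp : z != p by apply: adj_neq.
  have zq : z != q by apply: adj_neq.
  have := two _ _ _ z wS pS qS zS wpq zw zp zq.
  rewrite (negPf Nezw) /= orbF => /andP[ezp ezq].
  have up : u != p by apply: adj_neq.
  have uq : u != q by apply: adj_neq.
  have bad r : r \in S -> e w r -> e z r -> ~~ e u r.
    move=> rS ewr ezr; apply/negP => eur.
    have zru : triangle z r u by rewrite /triangle ezr ezu e_sym eur.
    have := two _ _ _ w zS rS uS wS zru.
    rewrite eq_sym zw e_neq // eq_sym uw (e_sym w z) (e_sym w u).
    rewrite (negPf Nezw) (negPf Neuw).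
    by rewrite andbF => /(_ isT isT isT).
  have tri_zpq : triangle z p q by rewrite /triangle ezp ezq epq.
  have := two _ _ _ u zS pS qS uS tri_zpq.
  rewrite eq_sym (e_neq _ _ ezu) up uq.
  rewrite (negPf (bad p pS ewp ezp)) (negPf (bad q qS ewq ezq)).
  by rewrite !andbF => /(_ isT isT isT).
move=> u w uS wS uw Neuw.
have sub_uw x : x \in [set u; w] -> x \in S by case/set2P=> ->.
exists [set u; w], (S :\: [set u; w]); split.
- by apply/setP=> x; rewrite !inE; case: eqVneq => [->|_]; case: eqVneq => [->|_].
- by rewrite disjoints_subset setCD subsetUr.
- by rewrite cards2 uw.
- have [p [q [pS qS /and3P[ewp epq ewq]]]] := in_tri w wS.
  have inB x : x \in S -> e w x -> x \in S :\: [set u; w].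
    move=> xS ewx; rewrite !inE xS andbT negb_or eq_sym andbC eq_sym.
    rewrite [w == x](negPf (e_neq _ _ ewx)) /=.
    by apply: contraNneq Neuw => ->; rewrite e_sym.
  by apply/card_gt1P; exists p, q; rewrite !inB ?e_neq.
move=> x x' y y' xA x'A /setDP[yS _] /setDP[y'S _] _ ex'y'.
case: (eqVneq x x') => [->//|xx'].
rewrite e_sym; apply: (twins x' x y') => //; rewrite 1?e_sym 1?eq_sym //.
- exact: sub_uw.
- exact: sub_uw.
by move: xA x'A xx'; rewrite !inE => /orP[]/eqP-> /orP[]/eqP->; rewrite ?eqxx // e_sym.
Qed.

Lemma parity_structure (S : {set T}) :
  [\/ clique e S,
      exists A B, [/\ A :|: B = S, #|A| < #|S|, #|B| < #|S|,
                      [disjoint A & B] & forall x y, x \in A -> y \in B -> ~~ e x y],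
      exists A B, splits S A B |
      exists c : T -> bool, forall x y, x \in S -> y \in S -> e x y -> c x != c y].
Proof.
have [conn|] := boolP [forall x in S, forall y in S, connect (restr S) x y]; last first.
  case/forall_inPn=> x xS /forall_inPn[y yS Nxy]; constructor 2.
  pose A := [set z in S | connect (restr S) x z].
  have xA : x \in A by rewrite inE xS connect0.
  have yA : y \notin A by rewrite inE yS.
  exists A, (S :\: A); split.
  - by apply/setP => z; rewrite !inE; case: (z \in S); rewrite ?andbF //= andbT orbN.
  - apply: proper_card; apply/properP; split; last by exists y.
    by apply/subsetP => z; rewrite inE => /andP[].
  - apply: proper_card; apply/properP; split; first exact: subsetDl.
    by exists x; rewrite // inE xA.
  - by rewrite disjoints_subset setCD subsetUr.
  move=> u w; rewrite inE => /andP[uS xu] /setDP[wS]; apply: contra => euw.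
  rewrite inE wS; apply: connect_trans xu _; apply: connect1.
  by rewrite /restr /= uS wS.
have {}conn x y : x \in S -> y \in S -> connect (restr S) x y.
  by move=> xS yS; apply: (forall_inP (forall_inP conn x xS)).
have [D dist] := dist_exists conn.
pose far v a b := [&& v \in S, a \in S, b \in S, e a b, D v a == D v b & 1 < D v a].
have [/existsP[v /existsP[a /existsP[b]]]|no_far] :=
    boolP [exists v, exists a, exists b, far v a b].
  case/and5P=> vS aS bS eab /andP[/eqP dab lt]; constructor 3.
  exact: (level_edge_split (dist v vS)) eab dab lt.
have low v a b : v \in S -> a \in S -> b \in S -> e a b -> D v a = D v b -> D v a <= 1.
  move=> vS aS bS eab dab; rewrite leqNgt; apply: contra no_far => lt.
  apply/existsP; exists v; apply/existsP; exists a; apply/existsP; exists b.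
  by rewrite /far vS aS bS eab dab eqxx -dab.
have [cl|] := boolP (clique e S); first by constructor 1.
case/forall_inPn=> u uS /forall_inPn[w wS]; rewrite negb_imply => /andP[uw Neuw].
pose tri x y z := [&& x \in S, y \in S, z \in S & triangle x y z].
have [/existsP[x /existsP[y /existsP[z]]]|no_tri] :=
    boolP [exists x, exists y, exists z, tri x y z].
  case/and4P=> xS yS zS xyz; constructor 3.
  exact: (nonadj_twins (two_of_three dist low) xS yS zS xyz uS wS uw Neuw).
constructor 4; exists (fun x => odd (D u x)) => x y xS yS exy.
have [_ d_eq0 d_lip _] := dist u uS.
have dxy : D u x != D u y.
  apply/eqP => dxy; have le1 := low u x y uS xS yS exy dxy.
  have [dx0|dx_neq0] := eqVneq (D u x) 0.
    have yu : y = u by apply: d_eq0; rewrite -?dxy.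
    by rewrite (d_eq0 x xS dx0) yu e_irr in exy.
  have dx1 : D u x = 1 by arith.
  case/negP: no_tri; apply/existsP; exists u.
  apply/existsP; exists x; apply/existsP; exists y.
  by rewrite /tri /triangle uS xS yS exy !(dist1_adj (dist u uS)) // -dxy.
have := d_lip x y xS yS exy; have := d_lip y x yS xS; rewrite e_sym exy => /(_ isT).
by arith.
Qed.

End Chordless.

(** * Halving lists of cliques *)

Section Halving.

Variables (T : finType) (e : rel T).
Hypotheses (e_sym : symmetric e) (e_irr : irreflexive e).

Lemma cliqueP (K : {set T}) :
  reflect (forall x y, x \in K -> y \in K -> x != y -> e x y) (clique e K).
Proof.
apply: (iffP forall_inP) => [cl x y xK yK|cl x xK].
  by apply/implyP; apply: (forall_inP (cl x xK)).
by apply/forall_inP => y yK; apply/implyP; apply: cl.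
Qed.

Definition cliques_in (S : {set T}) (L : seq {set T}) : bool :=
  all (fun K => clique e K && (K \subset S)) L.

Lemma cdeg_cat (L M : seq {set T}) v : cdeg (L ++ M) v = cdeg L v + cdeg M v.
Proof. exact: count_cat. Qed.

Lemma cliques_in_cat S L M : cliques_in S (L ++ M) = cliques_in S L && cliques_in S M.
Proof. exact: all_cat. Qed.

Lemma cdeg_out S L v : cliques_in S L -> v \notin S -> cdeg L v = 0.
Proof.
move=> /allP inS vS; apply/eqP; rewrite eqn0Ngt -has_count; apply/hasPn => K /inS.
by case/andP=> _ /subsetP sub; apply: contra vS; apply: sub.
Qed.

Lemma cliques_inW (S S' : {set T}) L : S \subset S' -> cliques_in S L -> cliques_in S' L.
Proof.
move=> sub; apply: sub_all => K /andP[-> /subset_trans]; exact.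
Qed.

(** Besides dropping maximality and allowing repetitions, this asks that the
degrees add up exactly: the degrees of the markers of a split then count the
crossing cliques, as the gluing requires. *)
Definition halves (S : {set T}) (L L1 L2 : seq {set T}) : Prop :=
  [/\ cliques_in S L1, cliques_in S L2, size L1 + size L2 <= size L &
      forall v, v \in S -> [/\ cdeg L1 v + cdeg L2 v = cdeg L v,
        cdeg L1 v <= (cdeg L2 v).+1 & cdeg L2 v <= (cdeg L1 v).+1]].

Definition halvable (S : {set T}) : Prop :=
  forall L, cliques_in S L -> exists L1 L2, halves S L L1 L2.

(** The cliques of P marked by b0 are merged one by one with the cliques of Q marked
by a0. *)
Lemma glue_cliques (A B : {set T}) a0 b0 P Q :
    [disjoint A & B] -> a0 \in A -> b0 \in B ->
    (forall x y, x \in A -> y \in B -> e x y = e x b0 && e a0 y) ->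
    cliques_in (b0 |: A) P -> cliques_in (a0 |: B) Q -> cdeg P b0 = cdeg Q a0 ->
  exists R, [/\ cliques_in (A :|: B) R, size R + cdeg P b0 = size P + size Q,
                forall v, v \in A -> cdeg R v = cdeg P v &
                forall v, v \in B -> cdeg R v = cdeg Q v].
Proof.
move=> disAB a0A b0B cross; elim: P Q => [|K P IHP] Q.
  move=> _ clQ /esym/= dQ0; exists Q; split=> //.
  - by apply: cliques_inW clQ; rewrite subUset sub1set inE a0A subsetUr.
  - by rewrite addn0.
  move=> v vA; have [->//|neq_v] := eqVneq v a0.
  apply: cdeg_out clQ _; rewrite !inE (negPf neq_v) /=.
  by rewrite (disjointFr disAB vA).
case/andP=> /andP[clK subK] clP clQ.
have KA x : x \in K -> x != b0 -> x \in A.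
  by move/(subsetP subK); rewrite !inE => /orP[->|].
have [b0K|b0NK] := boolP (b0 \in K); last first.
  rewrite /= (negPf b0NK) add0n => /(IHP Q clP clQ)[R [clR szR RA RB]].
  exists (K :: R); split.
  - rewrite /= clK; apply/andP; split=> //; apply/subsetP => x xK.
    by rewrite inE KA //; apply: contraNneq b0NK => <-.
  - by rewrite /= addSn szR addSn.
  - by move=> v vA; rewrite /= RA.
  - move=> v vB; rewrite /= RB //; case: (boolP (v \in K)) => // vK.
    have vA : v \in A by apply: KA => //; apply: contraNneq b0NK => <-.
    by rewrite (disjointFr disAB vA) in vB.
rewrite /= b0K add1n => dQ.
have /hasP[K' K'Q a0K'] : has (fun K : {set T} => a0 \in K) Q.
  by rewrite has_count -[count _ _]/(cdeg Q a0) -dQ.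
have permQ := perm_to_rem K'Q; pose Q' := rem K' Q.
have cdegQ v : cdeg Q v = (v \in K') + cdeg Q' v by rewrite /cdeg (permP permQ).
have : cliques_in (a0 |: B) (K' :: Q') by rewrite /cliques_in -(perm_all _ permQ).
case/andP=> /andP[clK' subK'] clQ'.
move: dQ; rewrite cdegQ a0K' add1n => -[/(IHP Q' clP clQ')[R [clR szR RA RB]]].
have K'B x : x \in K' -> x != a0 -> x \in B.
  by move/(subsetP subK'); rewrite !inE => /orP[->|].
pose J := (K :\ b0) :|: (K' :\ a0).
have JE x : x \in J ->
    (x \in K) && (x \in A) && e x b0 || (x \in K') && (x \in B) && e a0 x.
  case/setUP=> /setD1P[neq xK]; apply/orP; [left | right].
    by rewrite xK KA //= (cliqueP _ clK).
  by rewrite xK K'B //= (cliqueP _ clK') // eq_sym.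
exists (J :: R); split.
- rewrite /= -/(cliques_in _ R) clR andbT; apply/andP; split; last first.
    by apply/subsetP => x /JE; rewrite inE => /orP[]/andP[/andP[_ ->]]; rewrite ?orbT.
  apply/cliqueP => x y /JE xJ /JE yJ neq_xy.
  case/orP: xJ => /andP[/andP[xK xAB] ex]; case/orP: yJ => /andP[/andP[yK yAB] ey].
  - exact: (cliqueP _ clK).
  - by rewrite cross // ex ey.
  - by rewrite e_sym cross // ex ey.
  - exact: (cliqueP _ clK').
- have -> : size Q = (size Q').+1 by rewrite (perm_size permQ).
  rewrite /= !addSn !addnS szR; arith.
- move=> v vA; rewrite /= RA //; congr (_ + _); rewrite !inE.
  have vNB := disjointFr disAB vA.
  have -> : v != b0 by apply: contraFneq vNB => ->.
  have [->|neq_v] := eqVneq v a0; first by rewrite /= orbF.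
  rewrite /=; case: (boolP (v \in K')) => [/K'B/(_ neq_v)|_]; last by rewrite orbF.
  by rewrite vNB.
move=> v vB; rewrite /= RB // cdegQ; congr (_ + _); rewrite !inE.
have vNA := disjointFl disAB vB.
have -> : v != a0 by apply: contraFneq vNA => ->.
have [->|neq_v] := eqVneq v b0; first by rewrite /=.
rewrite /=; case: (boolP (v \in K)) => [/KA/(_ neq_v)|_] //.
by rewrite vNA.
Qed.

Definition meets (A K : {set T}) : bool := K :&: A != set0.

(** The traces on A of the cliques that meet A, where those that also meet B are
marked by the vertex b0, which stands for their part in B. *)
Definition marked (A B : {set T}) (b0 : T) (L : seq {set T}) : seq {set T} :=
  [seq [set x | (x \in K) && (x \in A) || (x == b0) && meets B K]
     | K : {set T} <- L & meets A K].

Lemma meetsP (A K : {set T}) : reflect (exists2 x, x \in K & x \in A) (meets A K).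
Proof.
by apply: (iffP (set0Pn _)) => -[x]; [case/setIP | move=> xK xA]; exists x; rewrite // inE xK.
Qed.

Lemma marked_cliques (A B : {set T}) b0 L :
    (forall x y, x \in A -> y \in B -> e x y -> e x b0) ->
    [disjoint A & B] -> b0 \in B ->
  cliques_in (A :|: B) L -> cliques_in (b0 |: A) (marked A B b0 L).
Proof.
move=> toB disAB b0B clL; rewrite /cliques_in all_map all_filter.
apply: sub_all clL => K /andP[/cliqueP clK subK]; apply/implyP => _ /=; apply/andP; split.
  have edge x : x \in K -> x \in A -> meets B K -> e x b0.
    move=> xK xA /meetsP[y yK yB]; apply: (toB x y) => //; apply: clK => //.
    by apply: contraTneq yB => <-; rewrite (disjointFr disAB xA).
  apply/cliqueP => x y; rewrite !inE.
  case/orP=> /andP[xK xA]; case/orP=> /andP[yK yA] neq_xy.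
  - exact: clK.
  - by rewrite (eqP yK); apply: edge.
  - by rewrite (eqP xK) e_sym; apply: edge.
  - by rewrite (eqP xK) (eqP yK) eqxx in neq_xy.
by apply/subsetP => x; rewrite !inE => /orP[/andP[_ ->]|/andP[-> _]]; rewrite ?orbT.
Qed.

Lemma cdeg_marked (A B : {set T}) b0 L v : v \in A -> v != b0 ->
  cdeg (marked A B b0 L) v = cdeg L v.
Proof.
move=> vA neq_v; rewrite /cdeg count_map count_filter; apply: eq_count => K /=.
rewrite inE vA (negPf neq_v) andbT orbF; case: (boolP (v \in K)) => // vK.
by apply/meetsP; exists v.
Qed.

Lemma size_marked (A B : {set T}) b0 L : size (marked A B b0 L) = count (meets A) L.
Proof. by rewrite size_map size_filter. Qed.

Lemma cdeg_marker (A B : {set T}) b0 L :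
  b0 \notin A -> cdeg (marked A B b0 L) b0 = count (predI (meets A) (meets B)) L.
Proof.
move=> b0A; rewrite /cdeg count_map count_filter; apply: eq_count => K /=.
by rewrite inE (negPf b0A) andbF eqxx andbC.
Qed.

Lemma halvable_split (A B : {set T}) a0 b0 :
    [disjoint A & B] -> a0 \in A -> b0 \in B ->
    (forall x y, x \in A -> y \in B -> e x y = e x b0 && e a0 y) ->
  halvable (b0 |: A) -> halvable (a0 |: B) -> halvable (A :|: B).
Proof.
move=> disAB a0A b0B cross hA hB L clL.
have b0NA : b0 \notin A by rewrite (disjointFl disAB b0B).
have a0NB : a0 \notin B by rewrite (disjointFr disAB a0A).
have [|P1 [P2 [clP1 clP2 szP degP]]] := hA (marked A B b0 L).
  by apply: marked_cliques => // x y xA yB; rewrite cross // => /andP[].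
have [|Q1 [Q2 [clQ1 clQ2 szQ degQ]]] := hB (marked B A a0 L).
  apply: marked_cliques; rewrite // 1?disjoint_sym 1?setUC //.
  by move=> y x yB xA; rewrite (e_sym y x) cross // (e_sym y a0) => /andP[].
have main Q1' Q2' : halves (a0 |: B) (marked B A a0 L) Q1' Q2' ->
    cdeg P1 b0 = cdeg Q1' a0 -> cdeg P2 b0 = cdeg Q2' a0 ->
  exists L1 L2, halves (A :|: B) L L1 L2.
  move=> {clQ1 clQ2 szQ degQ} [clQ1 clQ2 szQ degQ] d1 d2.
  have [R1 [clR1 szR1 R1A R1B]] := glue_cliques disAB a0A b0B cross clP1 clQ1 d1.
  have [R2 [clR2 szR2 R2A R2B]] := glue_cliques disAB a0A b0B cross clP2 clQ2 d2.
  exists R1, R2; split=> //.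
    have [degP0 _ _] := degP b0 (setU11 _ _); rewrite cdeg_marker // in degP0.
    rewrite !size_marked in szP szQ.
    have := count_predUI (meets A) (meets B) L.
    have := count_size (predU (meets A) (meets B)) L.
    arith.
  move=> v /setUP[vA|vB].
    have neq_v : v != b0 by apply: contraNneq b0NA => <-.
    by have := degP v (setU1r _ vA); rewrite cdeg_marked // R1A // R2A.
  have neq_v : v != a0 by apply: contraNneq a0NB => <-.
  by have := degQ v (setU1r _ vB); rewrite cdeg_marked // R1B // R2B.
have [dP leP1 leP2] := degP b0 (setU11 _ _).
have [dQ leQ1 leQ2] := degQ a0 (setU11 _ _).
rewrite cdeg_marker // in dP; rewrite cdeg_marker // in dQ.
have dPQ : cdeg P1 b0 + cdeg P2 b0 = cdeg Q1 a0 + cdeg Q2 a0.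
  by rewrite dP dQ; apply: eq_count => K /=; rewrite andbC.
(* Two even partitions of one number agree up to order. *)
have [eq1|neq1] := eqVneq (cdeg P1 b0) (cdeg Q1 a0).
  by apply: (main Q1 Q2) => //; arith.
apply: (main Q2 Q1); try arith.
split=> //; first by rewrite addnC.
by move=> v vB; have [? ? ?] := degQ v vB; rewrite addnC.
Qed.

Lemma halvable_disjoint (A B : {set T}) :
    (forall x y, x \in A -> y \in B -> ~~ e x y) -> [disjoint A & B] ->
  halvable A -> halvable B -> halvable (A :|: B).
Proof.
move=> no_cross disAB hA hB L clL.
have clLA : cliques_in A (filter (meets A) L).
  rewrite /cliques_in all_filter; apply: sub_all clL => K /andP[clK subK].
  apply/implyP => /meetsP[x xK xA]; rewrite clK; apply/subsetP => y yK.
  have /setUP[//|yB] := subsetP subK y yK.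
  case/negP: (no_cross x y xA yB); apply: (cliqueP _ clK) => //.
  by apply: contraTneq yB => <-; rewrite (disjointFr disAB xA).
have clLB : cliques_in B (filter (predC (meets A)) L).
  rewrite /cliques_in all_filter; apply: sub_all clL => K /andP[clK subK].
  apply/implyP => NKA; rewrite clK; apply/subsetP => y yK.
  have /setUP[yA|//] := subsetP subK y yK.
  by case/meetsP: NKA; exists y.
have [P1 [P2 [clP1 clP2 szP degP]]] := hA _ clLA.
have [Q1 [Q2 [clQ1 clQ2 szQ degQ]]] := hB _ clLB.
have degL v :
    cdeg L v = cdeg (filter (meets A) L) v + cdeg (filter (predC (meets A)) L) v.
  by rewrite -cdeg_cat /cdeg; apply/esym; apply/permP; rewrite perm_filterC.
exists (P1 ++ Q1), (P2 ++ Q2); split.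
- by rewrite cliques_in_cat !(cliques_inW _ clP1, cliques_inW _ clQ1) ?subsetUl ?subsetUr.
- by rewrite cliques_in_cat !(cliques_inW _ clP2, cliques_inW _ clQ2) ?subsetUl ?subsetUr.
- rewrite !size_cat addnACA (leq_trans (leq_add szP szQ)) // !size_filter.
  by rewrite count_predC.
move=> v /setUP[vA|vB]; rewrite !cdeg_cat degL.
  have vB : v \notin B by rewrite (disjointFr disAB vA).
  by rewrite (cdeg_out clQ1) // (cdeg_out clQ2) // (cdeg_out clLB) // !addn0; apply: degP.
have vA : v \notin A by rewrite (disjointFl disAB vB).
by rewrite (cdeg_out clP1) // (cdeg_out clP2) // (cdeg_out clLA) // !add0n; apply: degQ.
Qed.

Lemma count_ltn_iota m n : m <= n -> count (fun i => i < m) (iota 0 n) = m.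
Proof.
move=> le_mn; rewrite -(subnKC le_mn) iotaD count_cat add0n.
rewrite (eq_in_count (a2 := predT)) ?count_predT ?size_iota; last first.
  by move=> i; rewrite mem_iota.
rewrite (eq_in_count (a2 := pred0)) ?count_pred0 ?addn0 //.
by move=> i; rewrite mem_iota => /andP[le _]; rewrite ltnNge le.
Qed.

(** A list of n subsets of S that gives each vertex v the degree f v, provided that
f v <= n. *)
Definition layers (S : {set T}) (f : T -> nat) (n : nat) : seq {set T} :=
  [seq [set v in S | i < f v] | i <- iota 0 n].

Lemma cdeg_layers (S : {set T}) f n v :
  v \in S -> f v <= n -> cdeg (layers S f n) v = f v.
Proof.
move=> vS le_fn; rewrite /cdeg count_map -[RHS](count_ltn_iota le_fn).
by apply: eq_count => i /=; rewrite inE vS.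
Qed.

Lemma halvable_clique (S : {set T}) : clique e S -> halvable S.
Proof.
move=> /cliqueP clS L clL.
have cl_layers f n : cliques_in S (layers S f n).
  apply/allP => _ /mapP[i _ ->]; apply/andP; split; last first.
    by apply/subsetP => x; rewrite inE => /andP[].
  by apply/cliqueP => x y; rewrite !inE => /andP[xS _] /andP[yS _]; apply: clS.
exists (layers S (fun v => uphalf (cdeg L v)) (uphalf (size L))).
exists (layers S (fun v => (cdeg L v)./2) (size L)./2).
have halvesE n : uphalf n + n./2 = n.
  by rewrite uphalf_half -addnA addnn odd_double_half.
split=> //; first by rewrite !size_map !size_iota halvesE.
move=> v vS; have le : cdeg L v <= size L by apply: count_size.
rewrite !cdeg_layers ?half_leq ?uphalf_leq // halvesE.
by split=> //; rewrite uphalf_half; case: (odd _);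
  rewrite /= ?add1n ?add0n ?leqnSn // ?leqW.
Qed.

(** * Bipartite graphs *)

Section Bipartite.

Variable c : T -> bool.

Import GRing.Theory.

(** The signs are reversed on one colour class, so that an edge, seen as the pair
([:: K], [::]), becomes an arc from its end in one class to its end in the other:
the incidence matrix of a bipartite graph turns into that of a digraph. *)
Definition imbalance (it : seq {set T} * seq {set T}) (v : T) : int :=
  if c v then ((cdeg it.1 v)%:Z - (cdeg it.2 v)%:Z)%R
  else ((cdeg it.2 v)%:Z - (cdeg it.1 v)%:Z)%R.

(** An end may be missing, which accounts for cliques with at most one vertex. *)
Definition is_arc (it : seq {set T} * seq {set T}) : Prop :=
  exists s t : option T,
    forall v, imbalance it v =
      ((s == Some v : nat)%:Z - (t == Some v : nat)%:Z)%R.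

Lemma imbalance_cat P M P' M' v :
  imbalance (P ++ P', M ++ M') v = (imbalance (P, M) v + imbalance (P', M') v)%R.
Proof. by rewrite /imbalance /= !cdeg_cat; case: (c v); lia. Qed.

Lemma imbalance_flip P M v : imbalance (M, P) v = (- imbalance (P, M) v)%R.
Proof. by rewrite /imbalance /=; case: (c v); lia. Qed.

Lemma arc_flip P M : is_arc (P, M) -> is_arc (M, P).
Proof. by case=> s [t st]; exists t, s => v; rewrite imbalance_flip st; lia. Qed.

(** Two arcs that cancel at v form a single arc between their other ends. *)
Lemma arc_merge P M P' M' v :
    is_arc (P, M) -> is_arc (P', M') -> imbalance (P, M) v != 0%R ->
    imbalance (P', M') v = (- imbalance (P, M) v)%R ->
  is_arc (P ++ P', M ++ M').
Proof.
case=> s [t st] [s' [t' st']] nz opp; rewrite st st' in nz opp.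
have [sv|nsv] := eqVneq s (Some v).
  have tv' : t' = Some v.
    apply/eqP; move: nz opp; rewrite sv eqxx.
    by case: (t == _); case: (s' == _); case: (t' == _); lia.
  by exists s', t => u; rewrite imbalance_cat st st' sv tv'; lia.
have tv : t = Some v.
  by apply/eqP; move: nz opp; rewrite (negPf nsv); case: (t == _) => //; lia.
have sv' : s' = Some v.
  apply/eqP; move: nz opp; rewrite (negPf nsv) tv eqxx.
  by case: (s' == _); case: (t' == _); lia.
by exists s, t' => u; rewrite imbalance_cat st st' tv sv'; lia.
Qed.

Lemma arc_imbalance it v : is_arc it -> (`|imbalance it v| <= 1)%R.
Proof. by case=> s [t ->]; case: (s == _); case: (t == _). Qed.

(** Choosing for each arc which part goes to L1 amounts to choosing its sign.  Two
arcs that share an end v are given signs that cancel at v and are then treated as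
one arc, of which there are fewer.  An arc that shares no end with the others may
get any sign; the last clause of the statement, for a vertex at which all other
arcs vanish, ensures that its ends receive no further contribution. *)
Lemma orient_arcs (items : seq (seq {set T} * seq {set T})) :
    (forall it, it \in items -> is_arc it) ->
  exists L1 L2, perm_eq (L1 ++ L2) (flatten [seq it.1 ++ it.2 | it <- items]) /\
    forall v, (`|imbalance (L1, L2) v| <= 1)%R /\
      ((forall it, it \in items -> imbalance it v = 0%R) -> imbalance (L1, L2) v = 0%R).
Proof.
have [n] := ubnP (size items); elim: n items => // n IHn [|[P M] items] le_n arcs.
  exists [::], [::]; split=> // v.
  by rewrite /imbalance /=; case: (c v).
have arcPM := arcs _ (mem_head _ _).
have arcs' it : it \in items -> is_arc it.
  by move=> itI; apply: arcs; rewrite inE itI orbT.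
have [/hasP[[P' M'] it'I /existsP[v /andP[nz nz']]]|/hasPn far] :=
    boolP (has (fun it => [exists v, (imbalance (P, M) v != 0%R)
                                     && (imbalance it v != 0%R)]) items).
  have arcPM' := arcs' _ it'I.
  have perm_items := perm_to_rem it'I; pose rest := rem (P', M') items.
  have szrest : (size rest).+1 = size items by rewrite (perm_size perm_items).
  have flat : perm_eq (flatten [seq it.1 ++ it.2 | it <- items])
      ((P' ++ M') ++ flatten [seq it.1 ++ it.2 | it <- rest]).
    exact: perm_flatten (perm_map _ perm_items).
  have [P2 [M2 [arc2 opp perm2 zero2]]] : exists P2 M2, [/\ is_arc (P2, M2),
      imbalance (P2, M2) v = (- imbalance (P, M) v)%R, perm_eq (P2 ++ M2) (P' ++ M') &
      forall u, imbalance (P', M') u = 0%R -> imbalance (P2, M2) u = 0%R].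
    have le1 := arc_imbalance v arcPM; have le1' := arc_imbalance v arcPM'.
    (* Both values are 1 or -1; if they agree, the second arc is reversed. *)
    have [eq_im|neq_im] := eqVneq (imbalance (P', M') v) (imbalance (P, M) v).
      exists M', P'; split; first exact: arc_flip.
      - by rewrite imbalance_flip eq_im.
      - by rewrite perm_catC.
      - by move=> u im0; rewrite imbalance_flip im0.
    exists P', M'; split=> //; move: nz nz' le1 le1' neq_im; clear.
    move: (imbalance (P, M) v) (imbalance (P', M') v) => x y; lia.
  case: (IHn ((P ++ P2, M ++ M2) :: rest)).
  - by rewrite /= szrest.
  - move=> it; rewrite inE => /orP[/eqP->|/mem_rem/arcs'//].
    exact: arc_merge opp.
  move=> L1 [L2 [permL balL]]; exists L1, L2; split.
    apply: perm_trans permL _ => /=.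
    apply/permP => q; have := permP flat q; have := permP perm2 q.
    rewrite !count_cat => eq2 eq_flat; rewrite eq_flat -eq2.
    by rewrite (addnACA (count q P)) -!addnA.
  move=> u; have [le1 zero] := balL u; split=> // all0; apply: zero => it.
  have itemsI it0 : it0 \in items -> imbalance it0 u = 0%R.
    by move=> it0I; apply: all0; rewrite inE it0I orbT.
  rewrite inE => /orP[/eqP->|/mem_rem/itemsI//].
  by rewrite imbalance_cat (zero2 u (itemsI _ it'I)) addr0 all0 ?mem_head.
have [//|L1 [L2 [permL balL]]] := IHn items _ arcs'.
exists (P ++ L1), (M ++ L2); split.
  apply/permP => q; have := permP permL q; rewrite /= !count_cat; lia.
move=> v; rewrite imbalance_cat; have [le1 zero] := balL v; split.
  have [->|nz] := eqVneq (imbalance (P, M) v) 0%R; first by rewrite add0r.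
  rewrite zero ?addr0 ?arc_imbalance // => it itI; apply/eqP.
  have := far it itI; rewrite negb_exists => /forallP/(_ v).
  by rewrite nz negbK.
move=> all0; rewrite all0 ?mem_head // add0r zero // => it itI.
by rewrite all0 // inE itI orbT.
Qed.

Lemma clique_arc (S K : {set T}) :
    (forall x y, x \in S -> y \in S -> e x y -> c x != c y) ->
    clique e K -> K \subset S ->
  is_arc ([:: K], [::]).
Proof.
move=> bip /cliqueP clK /subsetP subK.
have one b v : v \in K -> c v = b -> [pick x in K | c x == b] = Some v.
  move=> vK cv; case: pickP => [x /andP[xK /eqP cx]|/(_ v)]; last by rewrite vK cv eqxx.
  congr Some; apply: contraTeq isT => neq_xv.
  by have := bip x v (subK x xK) (subK v vK) (clK x v xK vK neq_xv); rewrite cx cv eqxx.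
have oneE b v : ([pick x in K | c x == b] == Some v) = (v \in K) && (c v == b).
  apply/eqP/idP => [|/andP[vK /eqP]]; last exact: one.
  by case: pickP => // x xK [<-].
exists [pick x in K | c x == true], [pick x in K | c x == false] => v.
rewrite !oneE /imbalance /=.
by case: (c v); case: (v \in K).
Qed.

Lemma halvable_bipartite (S : {set T}) :
    (forall x y, x \in S -> y \in S -> e x y -> c x != c y) ->
  halvable S.
Proof.
move=> bip L clL.
have [|L1 [L2 [permL balL]]] := @orient_arcs [seq ([:: K], [::]) | K <- L].
  by move=> it /mapP[K /(allP clL)/andP[clK subK] ->]; apply: clique_arc subK.
have {}permL : perm_eq (L1 ++ L2) L.
  apply: perm_trans permL _; rewrite -map_comp.
  by rewrite [X in perm_eq X](_ : _ = L) //; elim: (L) => //= K L' ->.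
have : cliques_in S (L1 ++ L2) by rewrite /cliques_in (perm_all _ permL).
rewrite cliques_in_cat => /andP[cl1 cl2]; exists L1, L2; split=> //.
  by rewrite -size_cat (perm_size permL).
move=> v _; have [bal _] := balL v.
have degL : cdeg L1 v + cdeg L2 v = cdeg L v by rewrite -cdeg_cat /cdeg (permP permL).
by move: bal; rewrite /imbalance /=; case: (c v); split=> //; lia.
Qed.

End Bipartite.

(** * Parity graphs are equitably subpartitionable *)

(** Each side with its marker is smaller than S because the other side has at least
two vertices. *)
Lemma halvable_splits (S A B : {set T}) :
    splits e S A B ->
    (forall S' : {set T}, #|S'| < #|S| -> halvable S') ->
  halvable S.
Proof.
case=> <- disAB A_gt1 B_gt1 cross IH.
have szS : #|A :|: B| = #|A| + #|B|.
  by rewrite cardsU (disjoint_setI0 disAB) cards0 subn0.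
have size1 x (C : {set T}) : #|x |: C| <= #|C|.+1.
  by rewrite cardsU1; case: (_ \notin _); lia.
have [a0 [b0 [a0A b0B crossE]]] : exists a0 b0, [/\ a0 \in A, b0 \in B &
    forall x y, x \in A -> y \in B -> e x y = e x b0 && e a0 y].
  have [/exists_inP[a0 a0A /exists_inP[b0 b0B ab]]|no] :=
      boolP [exists a0 in A, exists b0 in B, e a0 b0].
    exists a0, b0; split=> // x y xA yB; apply/idP/andP => [exy|[exb eay]].
      by split; [apply: cross exy ab | apply: cross ab exy].
    exact: cross exb eay.
  have [/card_gt0P[a0 a0A] /card_gt0P[b0 b0B]] := (ltnW A_gt1, ltnW B_gt1).
  have none x y : x \in A -> y \in B -> e x y = false.
    move=> xA yB; apply: contraNF no => exy.
    by apply/exists_inP; exists x => //; apply/exists_inP; exists y.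
  by exists a0, b0; split=> // x y xA yB; rewrite !none.
apply: halvable_split crossE _ _ => //; apply: IH; rewrite szS.
  by have := size1 b0 A; lia.
by have := size1 a0 B; lia.
Qed.

Lemma parity_halvable (S : {set T}) : parity_graph e -> halvable S.
Proof.
move=> par; have [n] := ubnP #|S|; elim: n S => // n IHn S; rewrite ltnS => le_n.
have IH (S' : {set T}) : #|S'| < #|S| -> halvable S'.
  by move=> lt; apply: IHn; apply: leq_trans le_n.
have [clS|[A [B [defS ltA ltB dis no]]]|[A [B spl]]|[c bip]] :=
    parity_structure e_sym e_irr par S.
- exact: halvable_clique.
- by rewrite -defS; apply: halvable_disjoint => //; apply: IH.
- exact: halvable_splits spl IH.
- exact: halvable_bipartite bip.
Qed.

End Halving.

Theorem theorem5p3 (T : finType) (e : rel T)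
  (e_sym : symmetric e) (e_irr : irreflexive e) :
  parity_graph e -> ESP e.
Proof.
move=> par Lam maxLam.
have [|L1 [L2 [cl1 cl2 sz deg]]] :=
    parity_halvable e_sym e_irr (S := [set: T]) par (L := enum Lam).
  apply/allP => K; rewrite mem_enum => /maxLam/maxsetp ->.
  exact: subsetT.
have cliques L : cliques_in e setT L -> all (clique e) L by apply: sub_all => K /andP[].
exists L1, L2; split; first by split; apply: cliques.
- by rewrite cardE.
- by move=> v; have [-> _ _] := deg v (in_setT v).
- by move=> v; have [] := deg v (in_setT v); rewrite leq_min; lia.
Qed.
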